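(* Let $\mathcal{Q}$ be a partially multiplicative quandle (PMQ) and let $\hat{\mathcal{Q}}$ be its completion. Then the canonical map $\mathcal{Q}\to\hat{\mathcal{Q}}$ is injective.
   Context: A quandle (with unit) is a set $\mathcal{Q}$ with an element $\mathbf{1}\in\mathcal{Q}$ (unit) and a binary operation $(a,b)\mapsto a^b$ (conjugation) such that: $(-)^a\colon\mathcal{Q}\to\mathcal{Q}$ is bijective for all $a$; $\mathbf{1}^a=\mathbf{1}$ and $a^{\mathbf{1}}=a$; $a^a=a$; $(a^b)^c=(a^c)^{(b^c)}$ for all $a,b,c$. A partial monoid is a set $M$ with an element $\mathbf{1}$, a subset $D\subseteq M\times M$ and a map $D\to M$, $(a,b)\mapsto ab$ (one says $ab$ is defined if $(a,b)\in D$), such that $\mathbf{1}a$ and $a\mathbf{1}$ are defined and equal to $a$, and for all $a,b,c$: ($ab$ and $(ab)c$ are defined) if and only if ($bc$ and $a(bc)$ are defined), in which case $(ab)c=a(bc)$. A PMQ is a set $\mathcal{Q}$ that is both a quandle and a partial monoid with the same unit, such that for all $a,b,c$: (1) $ab$ is defined iff $b(a^b)$ is defined, and then $ab=b(a^b)$; (2) $a^{(bc)}=(a^b)^c$ whenever $bc$ is defined; (3) $ab$ is defined iff $(a^c)(b^c)$ is defined, and then $(ab)^c=(a^c)(b^c)$. A map of PMQs is a map of sets preserving unit, conjugation and defined products (if $ab$ is defined, then $f(a)f(b)$ is defined and equals $f(ab)$). A PMQ is complete if its product is defined for all pairs of elements. The completion of $\mathcal{Q}$ is the complete PMQ $\hat{\mathcal{Q}}$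 with a map of PMQs $\mathcal{Q}\to\hat{\mathcal{Q}}$, $a\mapsto\hat a$, that is initial among maps of PMQs from $\mathcal{Q}$ to complete PMQs. As a monoid, $\hat{\mathcal{Q}}$ is generated by elements $\hat a$, $a\in\mathcal{Q}$, with relations $\hat{\mathbf{1}}=\mathbf{1}$, $\hat a\hat b=\widehat{ab}$ whenever $ab$ is defined in $\mathcal{Q}$, and $\hat a\hat b=\hat b\,\widehat{a^b}$ for all $a,b\in\mathcal{Q}$. *)

(* Defs.v *)
From HB Require Import structures.
From mathcomp Require Import all_boot.

Set Implicit Arguments.
Unset Strict Implicit.
Unset Printing Implicit Defensive.

HB.mixin Record HasUnit (T : Type) := { unit1 : T }.

#[short(type="unitalType")]
HB.structure Definition Unital := { T of HasUnit T }.

(* [qconj a b] is the conjugate a^b. *)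
HB.mixin Record IsQuandle (T : Type) of HasUnit T := {
  qconj : T -> T -> T;
  qconj_bij : forall a, bijective (fun x => qconj x a);
  qconj1q : forall a, qconj unit1 a = unit1;
  qconjq1 : forall a, qconj a unit1 = a;
  qconjqq : forall a, qconj a a = a;
  qconjD : forall a b c, qconj (qconj a b) c = qconj (qconj a c) (qconj b c)
}.

#[short(type="quandleType")]
HB.structure Definition Quandle := { T of IsQuandle T & HasUnit T }.

(* [pmul a b = Some c] means that the product ab is defined and equal to c;
   [pmul a b = None] means that it is undefined.  An equation between
   option-valued expressions therefore says that one side is defined if and
   only if the other is, in which case the two values agree.  In [pmulA], the
   left-hand side is defined iff ab and (ab)c are. *)
HB.mixin Record IsPartialMonoid (T : Type) of HasUnit T := {
  pmul : T -> T -> option T;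
  pmul1m : forall a, pmul unit1 a = Some a;
  pmulm1 : forall a, pmul a unit1 = Some a;
  pmulA : forall a b c,
    obind (fun ab => pmul ab c) (pmul a b) =
    obind (fun bc => pmul a bc) (pmul b c)
}.

#[short(type="partialMonoidType")]
HB.structure Definition PartialMonoid :=
  { T of IsPartialMonoid T & HasUnit T }.

HB.mixin Record IsPMQ (T : Type) of Quandle T & PartialMonoid T := {
  pmul_qconj : forall a b : T, pmul a b = pmul b (qconj a b);
  qconj_pmul : forall a b c bc : T,
    pmul b c = Some bc -> qconj a bc = qconj (qconj a b) c;
  pmul_qconjr : forall a b c : T,
    omap (fun ab => qconj ab c) (pmul a b) = pmul (qconj a c) (qconj b c)
}.

#[short(type="pmqType")]
HB.structure Definition PMQ :=
  { T of IsPMQ T & Quandle T & PartialMonoid T }.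

Definition is_pmq_map (P Q : pmqType) (f : P -> Q) : Prop :=
  [/\ f unit1 = unit1,
      forall a b, f (qconj a b) = qconj (f a) (f b)
    & forall a b ab, pmul a b = Some ab -> pmul (f a) (f b) = Some (f ab)].

Definition complete_pmq (Q : pmqType) : Prop :=
  forall a b : Q, exists ab, pmul a b = Some ab.

(* [eta] exhibits [Qhat] as the completion of [Q]: it is initial among the
   maps of PMQs from [Q] to complete PMQs. *)
Definition is_completion (Q Qhat : pmqType) (eta : Q -> Qhat) : Prop :=
  [/\ complete_pmq Qhat,
      is_pmq_map eta
    & forall (R : pmqType) (f : Q -> R), complete_pmq R -> is_pmq_map f ->
      exists g : Qhat -> R,
        [/\ is_pmq_map g,
            forall a, g (eta a) = f a
          & forall h : Qhat -> R, is_pmq_map h ->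
              (forall a, h (eta a) = f a) -> forall x, h x = g x]].

(* Main.v *)
Require Import Defs.
From HB Require Import structures.
From mathcomp Require Import all_boot.
From mathcomp Require boolp.

(** By the universal property it suffices to embed [Q] into one complete PMQ.
    Let [G] be the group of PMQ automorphisms of [Q], acting on the right, and
    let [inner : Q -> G] send [a] to conjugation by [a].  The disjoint union of
    [Q] and [G] is a complete PMQ: a product that is undefined in [Q] takes the
    value [inner a * inner b] in [G], an element of [G] acts on [Q] by evaluation
    and on [G] by group conjugation, and [G] is absorbing for the product. *)

Set Implicit Arguments.
Unset Strict Implicit.
Unset Printing Implicit Defensive.

(** * The automorphism group of [Q] *)

Section Automorphisms.

Variable Q : pmqType.

(** The last clause, an equation of options, makes [f] reflect definedness as well as preserve
    products, which a map of PMQs need not do. *)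
Definition is_pmq_aut (f : Q -> Q) : Prop :=
  [/\ f unit1 = unit1,
      forall a b, f (qconj a b) = qconj (f a) (f b)
    & forall a b, omap f (pmul a b) = pmul (f a) (f b)].

Record pmq_aut := PMQAut {
  aut_fun :> Q -> Q;
  aut_inv_fun : Q -> Q;
  aut_funK : cancel aut_fun aut_inv_fun;
  aut_inv_funK : cancel aut_inv_fun aut_fun;
  aut_funP : is_pmq_aut aut_fun }.

(** The inverse is determined by the underlying function, and the other fields are proofs, equal by
    proof irrelevance. *)
Lemma pmq_aut_ext (g h : pmq_aut) : g =1 h -> g = h.
Proof.
case: g h => [f f' fK f'K fP] [k k' kK k'K kP] /= /boolp.funext fk.
rewrite -{k}fk in kK k'K kP *.
have /boolp.funext k'E : f' =1 k' by move=> x; rewrite -[x in LHS]k'K fK.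
rewrite -{k'}k'E in kK k'K *.
by congr PMQAut; apply: boolp.Prop_irrelevance.
Qed.

Lemma aut1 (g : pmq_aut) : g unit1 = unit1.
Proof. by have [] := aut_funP g. Qed.

Lemma aut_qconj (g : pmq_aut) a b : g (qconj a b) = qconj (g a) (g b).
Proof. by have [] := aut_funP g. Qed.

Lemma aut_pmul (g : pmq_aut) a b : omap g (pmul a b) = pmul (g a) (g b).
Proof. by have [] := aut_funP g. Qed.

Lemma id_is_pmq_aut : is_pmq_aut id.
Proof. by split=> // a b; case: pmul. Qed.

Definition aut_id : pmq_aut :=
  @PMQAut id id (fun=> erefl) (fun=> erefl) id_is_pmq_aut.

Lemma comp_is_pmq_aut (g h : pmq_aut) : is_pmq_aut (h \o g).
Proof.
split=> [|a b|a b] /=; first by rewrite !aut1.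
  by rewrite !aut_qconj.
by rewrite -!aut_pmul; case: pmul.
Qed.

(* Composition is in diagrammatic order, since conjugation is a right action. *)
Definition aut_mul (g h : pmq_aut) : pmq_aut :=
  PMQAut (can_comp (aut_funK h) (aut_funK g))
         (can_comp (aut_inv_funK g) (aut_inv_funK h)) (comp_is_pmq_aut g h).

Lemma inv_is_pmq_aut (g : pmq_aut) : is_pmq_aut (aut_inv_fun g).
Proof.
have gI := can_inj (aut_funK g).
split=> [|a b|a b]; first by rewrite -{1}(aut1 g) aut_funK.
  by apply: gI; rewrite aut_qconj !aut_inv_funK.
apply: (inj_omap gI); rewrite aut_pmul !aut_inv_funK.
by case: pmul => //= x; rewrite aut_inv_funK.
Qed.

Definition aut_inv (g : pmq_aut) : pmq_aut :=
  PMQAut (aut_inv_funK g) (aut_funK g) (inv_is_pmq_aut g).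

Definition aut_conj (g h : pmq_aut) : pmq_aut := aut_mul (aut_inv h) (aut_mul g h).

Lemma aut_invK (g : pmq_aut) : cancel (aut_inv g) g.
Proof. exact: aut_inv_funK. Qed.

Lemma aut_conjE (g h : pmq_aut) x : aut_conj g h x = h (g (aut_inv h x)).
Proof. by []. Qed.

(** * Inner automorphisms *)

Lemma qconj_inverse (a : Q) :
  exists f, cancel (fun x => qconj x a) f /\ cancel f (fun x => qconj x a).
Proof. by have [f fK f'K] := qconj_bij a; exists f. Qed.

Lemma qconj_is_pmq_aut (a : Q) : is_pmq_aut (fun x => qconj x a).
Proof.
split=> [|b c|b c]; first exact: qconj1q.
  exact: qconjD.
exact: pmul_qconjr.
Qed.

(** The inverse is only known to exist, so [boolp.cid] chooses one; by [pmq_aut_ext] the choice is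
    immaterial. *)
Definition inner (a : Q) : pmq_aut :=
  let: exist _ (conj fK f'K) := boolp.cid (qconj_inverse a) in
  PMQAut fK f'K (qconj_is_pmq_aut a).

Lemma innerE (a x : Q) : inner a x = qconj x a.
Proof. by rewrite /inner; case: boolp.cid => f []. Qed.

Lemma inner1 : inner unit1 = aut_id.
Proof. by apply: pmq_aut_ext => x; rewrite innerE qconjq1. Qed.

Lemma inner_pmul (a b ab : Q) :
  pmul a b = Some ab -> inner ab = aut_mul (inner a) (inner b).
Proof.
by move=> abE; apply: pmq_aut_ext => x; rewrite /= !innerE (qconj_pmul _ _ _ _ abE).
Qed.

Lemma inner_aut (g : pmq_aut) a : inner (g a) = aut_conj (inner a) g.
Proof.
by apply: pmq_aut_ext => x; rewrite aut_conjE !innerE aut_qconj aut_invK.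
Qed.

Lemma aut_mulA : associative aut_mul.
Proof. by move=> f g h; apply: pmq_aut_ext. Qed.

Lemma aut_mul1g : left_id aut_id aut_mul.
Proof. by move=> g; apply: pmq_aut_ext. Qed.

Lemma aut_mulg1 : right_id aut_id aut_mul.
Proof. by move=> g; apply: pmq_aut_ext. Qed.

Lemma aut_mul_conj g h : aut_mul g h = aut_mul h (aut_conj g h).
Proof. by apply: pmq_aut_ext => x /=; rewrite aut_funK. Qed.

Lemma aut_conjg1 g : aut_conj g aut_id = g.
Proof. exact: pmq_aut_ext. Qed.

Lemma aut_conjgg g : aut_conj g g = g.
Proof. by apply: pmq_aut_ext => x; rewrite aut_conjE /= aut_inv_funK. Qed.

Lemma aut_conjgM f g h : aut_conj f (aut_mul g h) = aut_conj (aut_conj f g) h.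
Proof. exact: pmq_aut_ext. Qed.

Lemma aut_conjMg f g h :
  aut_conj (aut_mul f g) h = aut_mul (aut_conj f h) (aut_conj g h).
Proof. by apply: pmq_aut_ext => x; rewrite /= aut_funK. Qed.

(** * The extension of [Q] by its automorphism group *)

Inductive ext := Elt of Q | Aut of pmq_aut.

(** Together with [ext_act] this is an augmented quandle: [ext_aut] is equivariant for conjugation
    ([ext_aut_act]), and each [x] is fixed by [ext_aut x] ([ext_conjqq]). *)
Definition ext_aut (x : ext) : pmq_aut :=
  match x with Elt a => inner a | Aut g => g end.

Definition ext_act (x : ext) (g : pmq_aut) : ext :=
  match x with Elt a => Elt (g a) | Aut h => Aut (aut_conj h g) end.

Definition ext_conj (x y : ext) : ext := ext_act x (ext_aut y).

Definition ext_mul (x y : ext) : ext :=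
  if (x, y) is (Elt a, Elt b) then
    if pmul a b is Some ab then Elt ab else Aut (aut_mul (inner a) (inner b))
  else Aut (aut_mul (ext_aut x) (ext_aut y)).

Lemma ext_act1 x : ext_act x aut_id = x.
Proof. by case: x => //= g; rewrite aut_conjg1. Qed.

Lemma ext_actM x g h : ext_act x (aut_mul g h) = ext_act (ext_act x g) h.
Proof. by case: x => //= f; rewrite aut_conjgM. Qed.

Lemma ext_aut_act x g : ext_aut (ext_act x g) = aut_conj (ext_aut x) g.
Proof. by case: x => //= a; rewrite inner_aut. Qed.

Lemma ext_aut_mul x y : ext_aut (ext_mul x y) = aut_mul (ext_aut x) (ext_aut y).
Proof.
by case: x y => [a|g] [b|h] //=; rewrite /ext_mul; case abE: (pmul a b) => //=; apply: inner_pmul.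
Qed.

Lemma ext_mulAutl g y : ext_mul (Aut g) y = Aut (aut_mul g (ext_aut y)).
Proof. by []. Qed.

Lemma ext_mulAutr x g : ext_mul x (Aut g) = Aut (aut_mul (ext_aut x) g).
Proof. by case: x. Qed.

(** For two elements of [Q], [aut_pmul] puts the product and the product of the images both in [Q]
    or both in [G]. *)
Lemma ext_act_mul x y g :
  ext_act (ext_mul x y) g = ext_mul (ext_act x g) (ext_act y g).
Proof.
case: x y => [a|f] [b|h] /=; rewrite ?aut_conjMg -?inner_aut //.
rewrite /ext_mul -aut_pmul; case: pmul => //=.
by rewrite aut_conjMg !inner_aut.
Qed.

Lemma ext_act_bij g : bijective (ext_act^~ g).
Proof.
have gV : aut_mul g (aut_inv g) = aut_id.
  by apply: pmq_aut_ext => x /=; rewrite aut_funK.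
have Vg : aut_mul (aut_inv g) g = aut_id.
  by apply: pmq_aut_ext => x /=; rewrite aut_inv_funK.
by exists (ext_act^~ (aut_inv g)) => x; rewrite -ext_actM ?gV ?Vg ext_act1.
Qed.

Lemma ext_conj_bij y : bijective (ext_conj^~ y).
Proof. exact: ext_act_bij. Qed.

Lemma ext_conj1q y : ext_conj (Elt unit1) y = Elt unit1.
Proof. by rewrite /ext_conj /= aut1. Qed.

Lemma ext_conjq1 x : ext_conj x (Elt unit1) = x.
Proof. by rewrite /ext_conj /= inner1 ext_act1. Qed.

Lemma ext_conjqq x : ext_conj x x = x.
Proof.
by case: x => [a|g]; rewrite /ext_conj /= ?aut_conjgg // innerE qconjqq.
Qed.

(** Both sides are [x] acted on by a product in [G], and the two products agree by the group
    identity gh = h(g^h). *)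
Lemma ext_conjD x y z :
  ext_conj (ext_conj x y) z = ext_conj (ext_conj x z) (ext_conj y z).
Proof. by rewrite /ext_conj ext_aut_act -!ext_actM -aut_mul_conj. Qed.

(** The unit has to come from [Q]: [Aut aut_id] is not neutral, as it multiplies [Elt a] to
    [Aut (inner a)]. *)
Lemma ext_mul1m x : ext_mul (Elt unit1) x = x.
Proof. by case: x => [a|g] /=; rewrite /ext_mul /= ?pmul1m // inner1 aut_mul1g. Qed.

Lemma ext_mulm1 x : ext_mul x (Elt unit1) = x.
Proof. by case: x => [a|g] /=; rewrite /ext_mul /= ?pmulm1 // inner1 aut_mulg1. Qed.

(** If some factor lies in [G], so do both sides, and associativity in [G] applies. For three
    elements of [Q], [pmulA] makes both sides land in [Q] together or in [G] together. *)
Lemma ext_mulA x y z : ext_mul (ext_mul x y) z = ext_mul x (ext_mul y z).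
Proof.
case: x => [a|f]; last by rewrite !ext_mulAutl /= ext_aut_mul aut_mulA.
case: y => [b|g]; last by rewrite ext_mulAutr !ext_mulAutl ext_mulAutr aut_mulA.
case: z => [c|h]; last by rewrite !ext_mulAutr ext_aut_mul aut_mulA.
have := pmulA a b c; rewrite /ext_mul.
case abE: (pmul a b) => [ab|]; case bcE: (pmul b c) => [bc|] /=.
- move=> ->; case: pmul => //.
  by rewrite (inner_pmul abE) (inner_pmul bcE) aut_mulA.
(* As bc is undefined, [pmulA] forces (ab)c to be undefined, so both sides lie in [G]. *)
- by move=> ->; rewrite (inner_pmul abE) aut_mulA.
- by move=> <-; rewrite (inner_pmul bcE) aut_mulA.
by rewrite aut_mulA.
Qed.

Lemma ext_mul_conj x y : ext_mul x y = ext_mul y (ext_conj x y).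
Proof.
case: x y => [a|g] [b|h]; rewrite /ext_conj /ext_mul /= ?inner_aut -?aut_mul_conj //.
by rewrite innerE -pmul_qconj.
Qed.

(** * The complete PMQ structure on [ext] *)

HB.instance Definition _ := HasUnit.Build ext (Elt unit1).

HB.instance Definition _ :=
  IsQuandle.Build ext ext_conj_bij ext_conj1q ext_conjq1 ext_conjqq ext_conjD.

Definition ext_pmul (x y : ext) : option ext := Some (ext_mul x y).

Lemma ext_pmul1m x : ext_pmul unit1 x = Some x.
Proof. by rewrite /ext_pmul ext_mul1m. Qed.

Lemma ext_pmulm1 x : ext_pmul x unit1 = Some x.
Proof. by rewrite /ext_pmul ext_mulm1. Qed.

Lemma ext_pmulA x y z :
  obind (fun xy => ext_pmul xy z) (ext_pmul x y) =
  obind (fun yz => ext_pmul x yz) (ext_pmul y z).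
Proof. by rewrite /ext_pmul /= ext_mulA. Qed.

HB.instance Definition _ :=
  IsPartialMonoid.Build ext ext_pmul1m ext_pmulm1 ext_pmulA.

Lemma ext_pmul_qconj (x y : ext) : pmul x y = pmul y (qconj x y).
Proof. by congr Some; apply: ext_mul_conj. Qed.

Lemma ext_qconj_pmul (x y z yz : ext) :
  pmul y z = Some yz -> qconj x yz = qconj (qconj x y) z.
Proof.
by case=> <-; rewrite /qconj /= /ext_conj ext_aut_mul ext_actM.
Qed.

Lemma ext_pmul_qconjr (x y z : ext) :
  omap (fun xy => qconj xy z) (pmul x y) = pmul (qconj x z) (qconj y z).
Proof. by congr Some; apply: ext_act_mul. Qed.

HB.instance Definition _ :=
  IsPMQ.Build ext ext_pmul_qconj ext_qconj_pmul ext_pmul_qconjr.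

Lemma ext_complete : complete_pmq ext.
Proof. by move=> x y; exists (ext_mul x y). Qed.

Lemma Elt_is_pmq_map : is_pmq_map Elt.
Proof.
split=> // [a b|a b ab abE]; first by rewrite [RHS]/qconj /= /ext_conj /= innerE.
by rewrite /pmul /= /ext_pmul /ext_mul abE.
Qed.

End Automorphisms.

Theorem proposition1 (Q Qhat : pmqType) (eta : Q -> Qhat)
  (eta_completion : is_completion eta) : injective eta.
Proof.
have [_ _ initial] := eta_completion.
have [g [_ gE _]] := initial _ _ (@ext_complete Q) (@Elt_is_pmq_map Q).
(* The composite of [eta] and [g] is the constructor [Elt], which is injective. *)
by move=> a b /(congr1 g); rewrite !gE => -[].
Qed.
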